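(* There exists an absolute constant $c_1>0$ such that the following holds. For every positive integer $d$, all real numbers $\alpha_1,\dots,\alpha_d$, and every integer $N\geq 1$, there exists an integer $1\leq n\leq N$ such that \[\|n^2\alpha_j\|\leq \exp\bigl(-c_1(d^{-10}\log N)^{1/4}\bigr)\quad\text{for } j=1,\dots,d.\]
   Context: For $\alpha\in\mathbb R$, $\|\alpha\|$ denotes the distance from $\alpha$ to the nearest integer. *)

(* Defs.v *)
From Stdlib Require Import Reals.
Open Scope R_scope.

Definition floorR (x : R) : Z := Int_part x.

Definition dist_nint (x : R) : R :=
  Rmin (x - IZR (floorR x)) (IZR (floorR x) + 1 - x).

(* Main.v *)
Require Import Defs.
From Stdlib Require Import Reals Lra Lia ZArith Znumtheory Arith Classical.
From Stdlib Require Import IndefiniteDescription.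
Open Scope R_scope.

(** Write [n = sum_i x_i v_i], where Dirichlet's theorem supplies successive
    integers [v_i] with all [2 v_i v_i' alpha_j] close to integers, so that
    [n^2 alpha_j] is close to [sum_i x_i^2 beta_(i,j)] with
    [beta_(i,j) = v_i^2 alpha_j].  Applying the pigeonhole principle to subset
    sums of the vectors [beta_i], first inside blocks of indices and then to the
    block sums, gives four disjoint index sets whose [beta]-sums are all close to
    one vector [Gamma].  Letting [x] take the constant values [x1, ..., x4] on
    these four sets turns the form into [(x1^2 + x2^2 + x3^2 + x4^2) Gamma], and
    by Lagrange's four-square theorem the multiplier can be any positive integer
    [m]; Dirichlet's theorem makes [m Gamma] close to an integer vector. *)

(** * Pigeonhole for maps between initial segments *)

Lemma nat_pigeonhole (c b : nat) (f : nat -> nat) :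
  (c < b)%nat -> (forall i, (i < b)%nat -> (f i < c)%nat) ->
  exists i i', (i < i')%nat /\ (i' < b)%nat /\ f i = f i'.
Proof.
  intros Hcb Hf.
  apply NNPP; intros Hinj.
  assert (Hnd : List.NoDup (List.map f (List.seq 0 b))).
  { apply List.NoDup_map_NoDup_ForallPairs.
    - intros i i' Hi Hi' Heq.
      apply List.in_seq in Hi; apply List.in_seq in Hi'.
      destruct (lt_eq_lt_dec i i') as [[H|H]|H]; [|exact H|];
        exfalso; apply Hinj.
      + exists i, i'. repeat split; auto; lia.
      + exists i', i. repeat split; auto; lia.
    - apply List.seq_NoDup. }
  assert (Hle : (length (List.map f (List.seq 0 b)) <= length (List.seq 0 c))%nat).
  { apply (List.NoDup_incl_length Hnd).
    intros y Hy. apply List.in_map_iff in Hy. destruct Hy as [i [<- Hi]].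
    apply List.in_seq in Hi. apply List.in_seq. specialize (Hf i). lia. }
  rewrite List.length_map, !List.length_seq in Hle. lia.
Qed.

(** * Lagrange's four-square theorem *)

Section FourSquares.
Open Scope Z_scope.

Definition sum4sq (n : Z) : Prop :=
  exists a b c d : Z, n = a * a + b * b + c * c + d * d.

(** Euler's four-square identity. *)
Lemma sum4sq_mul (m n : Z) : sum4sq m -> sum4sq n -> sum4sq (m * n).
Proof.
  intros (a & b & c & d & ->) (x & y & z & w & ->).
  exists (a * x + b * y + c * z + d * w), (a * y - b * x + c * w - d * z),
    (a * z - c * x + d * y - b * w), (a * w - d * x + b * z - c * y).
  ring.
Qed.

Lemma centered_residue (m x : Z) :
  0 < m -> exists y t, x = y + m * t /\ - m <= 2 * y < m.
Proof.
  intros Hm.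
  exists (x - m * ((2 * x + m) / (2 * m))), ((2 * x + m) / (2 * m)).
  pose proof (Z.div_mod (2 * x + m) (2 * m) ltac:(lia)).
  pose proof (Z.mod_pos_bound (2 * x + m) (2 * m) ltac:(lia)).
  split; nia.
Qed.

Lemma prime_no_mid_divisor (p m k : Z) :
  prime p -> 1 < m < p -> p = m * k -> False.
Proof.
  intros Hp Hm Hk.
  destruct (prime_divisors p Hp m) as [H|[H|[H|H]]]; try lia.
  exists k. lia.
Qed.

(** Descent on the multiplier: reducing the four roots modulo [m] gives a sum of four squares
    [m * r] with [r <= m], and Euler's identity applied to [(m * p) * (m * r)] has all four roots
    divisible by [m], so [r * p] is a sum of four squares. In the extreme cases [r = 0] and [r = m],
    [m] would divide [p]. *)
Lemma four_squares_descent (p : Z) : prime p ->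
  forall m, 0 < m < p -> sum4sq (m * p) -> sum4sq p.
Proof.
  intros Hp.
  enough (H : forall m, 0 <= m -> m < p -> 0 < m -> sum4sq (m * p) -> sum4sq p)
    by (intros m Hm; apply (H m); lia).
  intros m Hm. pattern m. apply Zlt_0_ind; [|exact Hm]. clear m Hm.
  intros m IH _ Hmp Hm0 (x1 & x2 & x3 & x4 & Hx).
  destruct (Z.eq_dec m 1) as [->|Hm1].
  { exists x1, x2, x3, x4. lia. }
  destruct (centered_residue m x1 Hm0) as (y1 & t1 & -> & B1).
  destruct (centered_residue m x2 Hm0) as (y2 & t2 & -> & B2).
  destruct (centered_residue m x3 Hm0) as (y3 & t3 & -> & B3).
  destruct (centered_residue m x4 Hm0) as (y4 & t4 & -> & B4).
  (* Expanding the squares of [y_i + m * t_i] in [m * p] and dividing by [m] leaves this value for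
     the sum of the [y_i^2] over [m]. *)
  set (r := p - 2 * (y1 * t1 + y2 * t2 + y3 * t3 + y4 * t4)
            - m * (t1 * t1 + t2 * t2 + t3 * t3 + t4 * t4)).
  assert (Hr : y1 * y1 + y2 * y2 + y3 * y3 + y4 * y4 = m * r)
    by (unfold r; nia).
  assert (S1 : 4 * (y1 * y1) <= m * m) by nia.
  assert (S2 : 4 * (y2 * y2) <= m * m) by nia.
  assert (S3 : 4 * (y3 * y3) <= m * m) by nia.
  assert (S4 : 4 * (y4 * y4) <= m * m) by nia.
  assert (Hr0 : 0 <= r) by nia.
  assert (Hrm : r <= m) by nia.
  destruct (Z.eq_dec r 0) as [E|Hrn0].
  { exfalso. rewrite E in Hr.
    assert (y1 = 0) by nia. assert (y2 = 0) by nia.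
    assert (y3 = 0) by nia. assert (y4 = 0) by nia. subst y1 y2 y3 y4.
    apply (prime_no_mid_divisor p m (t1 * t1 + t2 * t2 + t3 * t3 + t4 * t4) Hp);
      [lia|].
    apply (Z.mul_reg_l _ _ m); [lia|]. rewrite Hx. ring. }
  destruct (Z.eq_dec r m) as [E|Hrnm].
  (* Here every [4 * y_i^2] attains its bound [m^2]; the half-open range of the residues then fixes
     the sign, so [2 * y_i = - m]. *)
  { exfalso. rewrite E in Hr.
    assert (2 * y1 = - m) by nia. assert (2 * y2 = - m) by nia.
    assert (2 * y3 = - m) by nia. assert (2 * y4 = - m) by nia.
    apply (prime_no_mid_divisor p m
      (1 + (t1 * t1 - t1) + (t2 * t2 - t2) + (t3 * t3 - t3) + (t4 * t4 - t4)) Hp);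
      [lia|].
    apply (Z.mul_reg_l _ _ m); [lia|]. rewrite Hx.
    replace m with (- (2 * y1)) in * by lia.
    replace y2 with y1 by lia. replace y3 with y1 by lia.
    replace y4 with y1 by lia. ring. }
  apply (IH r); try lia.
  (* These are the roots from Euler's identity for [y_i + m * t_i] and [y_i], each divided by
     [m]. *)
  exists (r + (t1 * y1 + t2 * y2 + t3 * y3 + t4 * y4)),
    (t1 * y2 - t2 * y1 + t3 * y4 - t4 * y3),
    (t1 * y3 - t3 * y1 + t4 * y2 - t2 * y4),
    (t1 * y4 - t4 * y1 + t2 * y3 - t3 * y2).
  apply (Z.mul_reg_l _ _ (m * m)); [nia|].
  replace (m * m * (r * p)) with ((m * p) * (m * r)) by ring.
  set (u := t1 * y1 + t2 * y2 + t3 * y3 + t4 * y4).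
  transitivity ((m * r + m * u) * (m * r + m * u)
    + (m * m) * ((t1 * y2 - t2 * y1 + t3 * y4 - t4 * y3) * (t1 * y2 - t2 * y1 + t3 * y4 - t4 * y3)
    + (t1 * y3 - t3 * y1 + t4 * y2 - t2 * y4) * (t1 * y3 - t3 * y1 + t4 * y2 - t2 * y4)
    + (t1 * y4 - t4 * y1 + t2 * y3 - t3 * y2) * (t1 * y4 - t4 * y1 + t2 * y3 - t3 * y2)));
    [|ring].
  rewrite Hx, <- Hr. unfold u. ring.
Qed.

Lemma prime_dvd_sq_diff (p a b : Z) : prime p ->
  0 <= a < b -> 2 * b < p -> (p | b * b - a * a) -> False.
Proof.
  intros Hp Hab Hb H.
  replace (b * b - a * a) with ((b - a) * (b + a)) in H by ring.
  destruct (prime_mult p Hp _ _ H) as [H'|H']; apply Z.divide_pos_le in H'; lia.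
Qed.

(** With [p = 2 * h + 1], the squares of [0..h] are distinct modulo [p], and so are the numbers
    [-1 - b^2] for [b] in [0..h]. These are [p + 1] numbers in all, so some [a^2] is congruent to
    some [-1 - b^2]. *)
Lemma prime_dvd_sum_two_squares_1 (p : Z) : prime p -> 2 < p ->
  exists a b, 0 <= 2 * a < p /\ 0 <= 2 * b < p /\ (p | a * a + b * b + 1).
Proof.
  intros Hp Hp2.
  assert (Hodd : exists h, 0 <= h /\ p = 2 * h + 1).
  { exists (p / 2). pose proof (Z.div_mod p 2 ltac:(lia)) as E.
    pose proof (Z.mod_pos_bound p 2 ltac:(lia)).
    destruct (Z.eq_dec (p mod 2) 0) as [E0|]; [|lia].
    exfalso. apply (prime_no_mid_divisor p 2 (p / 2) Hp); lia. }
  destruct Hodd as (h & Hh & E).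
  (* Indices [0..h] carry the squares, indices [h+1..2h+1] the numbers [-1 - b^2]; only a collision
     between the two ranges can survive. *)
  set (g := fun i : nat => let z := Z.of_nat i in
    if z <=? h then z * z else - 1 - (z - h - 1) * (z - h - 1)).
  destruct (nat_pigeonhole (Z.to_nat p) (Z.to_nat (p + 1))
    (fun i => Z.to_nat (g i mod p))) as (i & i' & Hi & Hi' & Hg); [lia| |].
  { intros i _. pose proof (Z.mod_pos_bound (g i) p ltac:(lia)). lia. }
  pose proof (Z.mod_pos_bound (g i) p ltac:(lia)).
  pose proof (Z.mod_pos_bound (g i') p ltac:(lia)).
  assert (Hdiv : (p | g i' - g i)).
  { apply Z.mod_divide; [lia|]. rewrite Zminus_mod.
    replace (g i' mod p) with (g i mod p) by lia.
    rewrite Z.sub_diag. reflexivity. }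
  unfold g in Hdiv.
  destruct (Z.leb_spec (Z.of_nat i) h) as [L|L];
    destruct (Z.leb_spec (Z.of_nat i') h) as [L'|L']; cbv zeta in Hdiv.
  - exfalso. apply (prime_dvd_sq_diff p (Z.of_nat i) (Z.of_nat i')); auto; lia.
  - exists (Z.of_nat i), (Z.of_nat i' - h - 1). split; [lia|]. split; [lia|].
    apply Z.divide_opp_r. eapply Z.divide_trans; [exact Hdiv|].
    exists 1. ring.
  - lia.
  - exfalso. apply (prime_dvd_sq_diff p (Z.of_nat i - h - 1) (Z.of_nat i' - h - 1));
      auto; try lia.
    apply Z.divide_opp_r. eapply Z.divide_trans; [exact Hdiv|].
    exists 1. ring.
Qed.

Lemma sum4sq_prime (p : Z) : prime p -> sum4sq p.
Proof.
  intros Hp. pose proof (prime_ge_2 p Hp).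
  destruct (Z.eq_dec p 2) as [->|]; [exists 1, 1, 0, 0; reflexivity|].
  destruct (prime_dvd_sum_two_squares_1 p Hp ltac:(lia)) as (a & b & Ha & Hb & m & Hm).
  apply (four_squares_descent p Hp m).
  (* Since [a] and [b] lie below [p / 2], the multiplier in [a^2 + b^2 + 1 = m * p] is less than
     [p], as the descent requires. *)
  - split; nia.
  - exists a, b, 1, 0. lia.
Qed.

Lemma sum4sq_nonneg (n : Z) : 0 <= n -> sum4sq n.
Proof.
  intros Hn. pattern n. apply Zlt_0_ind; [|exact Hn]. clear n Hn.
  intros n IH Hn.
  destruct (Z_le_gt_dec n 1) as [H1|H1].
  { exists n, 0, 0, 0. nia. }
  destruct (prime_dec n) as [Hp|Hp]; [exact (sum4sq_prime n Hp)|].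
  destruct (not_prime_divide n ltac:(lia) Hp) as (a & Ha & b & ->).
  apply sum4sq_mul; apply IH; nia.
Qed.

End FourSquares.

Lemma four_squares (n : nat) : exists a b c d : nat,
  n = (a * a + b * b + c * c + d * d)%nat.
Proof.
  destruct (sum4sq_nonneg (Z.of_nat n) ltac:(lia)) as (a & b & c & d & H).
  exists (Z.abs_nat a), (Z.abs_nat b), (Z.abs_nat c), (Z.abs_nat d). nia.
Qed.

(** * Finite sums of reals and of naturals *)

Fixpoint rsum (n : nat) (f : nat -> R) : R :=
  match n with
  | O => 0
  | S n' => rsum n' f + f n'
  end.

Lemma rsum_ext (n : nat) (f g : nat -> R) :
  (forall i, (i < n)%nat -> f i = g i) -> rsum n f = rsum n g.
Proof.
  induction n as [|n IH]; simpl; intros H; [reflexivity|].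
  rewrite IH, H; auto.
Qed.

Lemma rsum_plus (n : nat) (f g : nat -> R) :
  rsum n (fun i => f i + g i) = rsum n f + rsum n g.
Proof. induction n as [|n IH]; simpl; [ring|rewrite IH; ring]. Qed.

Lemma rsum_scal (n : nat) (c : R) (f : nat -> R) :
  rsum n (fun i => c * f i) = c * rsum n f.
Proof. induction n as [|n IH]; simpl; [ring|rewrite IH; ring]. Qed.

Lemma rsum_add (m n : nat) (f : nat -> R) :
  rsum (m + n) f = rsum m f + rsum n (fun i => f (m + i)%nat).
Proof.
  induction n as [|n IH]; simpl.
  - rewrite Nat.add_0_r. ring.
  - rewrite Nat.add_succ_r. simpl. rewrite IH. ring.
Qed.

Lemma rsum_mul (m n : nat) (f : nat -> R) :
  rsum (m * n) f = rsum m (fun b => rsum n (fun i => f (b * n + i)%nat)).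
Proof.
  induction m as [|m IH]; [reflexivity|].
  rewrite Nat.mul_succ_l, rsum_add, IH. reflexivity.
Qed.

Fixpoint nsum (n : nat) (f : nat -> nat) : nat :=
  match n with
  | O => O
  | S n' => (nsum n' f + f n')%nat
  end.

Lemma INR_nsum (n : nat) (f : nat -> nat) :
  INR (nsum n f) = rsum n (fun i => INR (f i)).
Proof. induction n as [|n IH]; simpl; [|rewrite plus_INR, IH]; reflexivity. Qed.

Lemma nsum_le (n c : nat) (f : nat -> nat) :
  (forall i, (i < n)%nat -> (f i <= c)%nat) -> (nsum n f <= n * c)%nat.
Proof.
  induction n as [|n IH]; simpl; intros H; [lia|].
  specialize (IH (fun i Hi => H i ltac:(lia))). specialize (H n ltac:(lia)). lia.
Qed.

Lemma nsum_ge_term (n i : nat) (f : nat -> nat) :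
  (i < n)%nat -> (f i <= nsum n f)%nat.
Proof.
  induction n as [|n IH]; simpl; intros H; [lia|].
  destruct (Nat.eq_dec i n) as [->|]; [lia|]. specialize (IH ltac:(lia)). lia.
Qed.

(** * Closeness to an integer *)

(** A form of the bound on the distance to the nearest integer with an explicit integer witness, so
    that errors add under sums and scale under multiples without reference to [floorR]. *)
Definition near_int (x e : R) : Prop := exists k : Z, Rabs (x - IZR k) <= e.

Lemma near_int_le (x e e' : R) : near_int x e -> e <= e' -> near_int x e'.
Proof. intros [k Hk] H. exists k. lra. Qed.

Lemma near_int_0 (e : R) : 0 <= e -> near_int 0 e.
Proof. intros H. exists 0%Z. rewrite Rminus_0_r, Rabs_R0. exact H. Qed.

Lemma near_int_plus (x y e e' : R) :
  near_int x e -> near_int y e' -> near_int (x + y) (e + e').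
Proof.
  intros [k Hk] [l Hl]. exists (k + l)%Z. rewrite plus_IZR.
  replace (x + y - (IZR k + IZR l)) with ((x - IZR k) + (y - IZR l)) by ring.
  pose proof (Rabs_triang (x - IZR k) (y - IZR l)). lra.
Qed.

Lemma near_int_opp (x e : R) : near_int x e -> near_int (- x) e.
Proof.
  intros [k Hk]. exists (- k)%Z. rewrite opp_IZR.
  replace (- x - - IZR k) with (- (x - IZR k)) by ring.
  rewrite Rabs_Ropp. exact Hk.
Qed.

Lemma near_int_minus (x y e e' : R) :
  near_int x e -> near_int y e' -> near_int (x - y) (e + e').
Proof. intros Hx Hy. apply near_int_plus; [|apply near_int_opp]; assumption. Qed.

Lemma near_int_scal (n : nat) (x e : R) :
  near_int x e -> near_int (INR n * x) (INR n * e).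
Proof.
  intros [k Hk]. exists (Z.of_nat n * k)%Z.
  rewrite mult_IZR, <- INR_IZR_INZ.
  replace (INR n * x - INR n * IZR k) with (INR n * (x - IZR k)) by ring.
  rewrite Rabs_mult, (Rabs_pos_eq (INR n)) by apply pos_INR.
  apply Rmult_le_compat_l; [apply pos_INR|exact Hk].
Qed.

Lemma near_int_rsum (n : nat) (f : nat -> R) (e : R) :
  (forall i, (i < n)%nat -> near_int (f i) e) ->
  near_int (rsum n f) (INR n * e).
Proof.
  induction n as [|n IH]; intros H.
  - simpl. apply near_int_0. lra.
  - rewrite S_INR, Rmult_plus_distr_r, Rmult_1_l.
    apply near_int_plus; auto.
Qed.

Lemma near_int_dist_nint (x e : R) : near_int x e -> dist_nint x <= e.
Proof.
  intros [k Hk]. unfold dist_nint, floorR.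
  destruct (base_Int_part x) as [H1 H2].
  destruct (Z_le_gt_dec k (Int_part x)) as [L|L].
  - apply IZR_le in L. pose proof (Rle_abs (x - IZR k)).
    eapply Rle_trans; [apply Rmin_l|lra].
  - assert (L' : (Int_part x + 1 <= k)%Z) by lia.
    apply IZR_le in L'. rewrite plus_IZR in L'.
    pose proof (Rle_abs (- (x - IZR k))). rewrite Rabs_Ropp in *.
    eapply Rle_trans; [apply Rmin_r|lra].
Qed.

Lemma dist_nint_le_half (x : R) : dist_nint x <= / 2.
Proof.
  unfold dist_nint, Rmin. destruct (Rle_dec _ _); lra.
Qed.

(** * Pigeonhole on the torus and Dirichlet's theorem *)

Definition cell (Q : nat) (x : R) : nat :=
  Z.to_nat (Int_part (INR Q * frac_part x)).

Lemma cell_spec (Q : nat) (x : R) : (0 < Q)%nat ->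
  (cell Q x < Q)%nat /\
  INR (cell Q x) <= INR Q * frac_part x < INR (cell Q x) + 1.
Proof.
  intros HQ. apply lt_0_INR in HQ.
  destruct (base_fp x) as [F1 F2].
  destruct (base_Int_part (INR Q * frac_part x)) as [H1 H2].
  assert (H0 : (0 <= Int_part (INR Q * frac_part x))%Z).
  { apply Z.lt_succ_r, lt_IZR. rewrite succ_IZR. nra. }
  assert (E : INR (cell Q x) = IZR (Int_part (INR Q * frac_part x))).
  { unfold cell. rewrite (INR_IZR_INZ (Z.to_nat _)), Z2Nat.id by exact H0.
    reflexivity. }
  rewrite E. split; [|lra].
  apply INR_lt. rewrite E. nra.
Qed.

Lemma same_cell_near (Q : nat) (x y : R) : (0 < Q)%nat ->
  cell Q x = cell Q y -> near_int (x - y) (/ INR Q).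
Proof.
  intros HQ E.
  destruct (cell_spec Q x HQ) as [_ Hx]. destruct (cell_spec Q y HQ) as [_ Hy].
  rewrite E in Hx. apply lt_0_INR in HQ.
  exists (Int_part x - Int_part y)%Z. rewrite minus_IZR.
  replace (x - y - (IZR (Int_part x) - IZR (Int_part y)))
    with (frac_part x - frac_part y) by (unfold frac_part; ring).
  apply (Rmult_le_reg_l (INR Q)); [exact HQ|].
  rewrite Rinv_r by lra.
  rewrite <- (Rabs_pos_eq (INR Q)), <- Rabs_mult by lra.
  apply Rabs_le. lra.
Qed.

(** Base-[Q] encoding of a [d]-tuple of cells, which names each of the [Q ^ d] subcubes of the torus
    by one natural number. *)
Fixpoint digits_value (Q : nat) (c : nat -> nat) (d : nat) : nat :=
  match d with
  | O => O
  | S d' => (digits_value Q c d' * Q + c d')%nat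
  end.

Lemma digits_value_lt (Q : nat) (c : nat -> nat) (d : nat) :
  (forall j, (j < d)%nat -> (c j < Q)%nat) -> (digits_value Q c d < Q ^ d)%nat.
Proof.
  induction d as [|d IH]; simpl; intros H; [lia|].
  specialize (IH (fun j Hj => H j ltac:(lia))). specialize (H d ltac:(lia)). nia.
Qed.

Lemma digits_value_inj (Q : nat) (c c' : nat -> nat) (d : nat) :
  (forall j, (j < d)%nat -> (c j < Q)%nat) ->
  (forall j, (j < d)%nat -> (c' j < Q)%nat) ->
  digits_value Q c d = digits_value Q c' d ->
  forall j, (j < d)%nat -> c j = c' j.
Proof.
  induction d as [|d IH]; simpl; intros H H' E j Hj; [lia|].
  pose proof (H d ltac:(lia)). pose proof (H' d ltac:(lia)).
  assert (digits_value Q c d = digits_value Q c' d) by nia.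
  destruct (Nat.eq_dec j d) as [->|]; [nia|].
  apply IH; auto; lia.
Qed.

Lemma torus_pigeonhole (d Q B : nat) (p : nat -> nat -> R) :
  (0 < Q)%nat -> (Q ^ d < B)%nat ->
  exists i i', (i < i')%nat /\ (i' < B)%nat /\
    forall j, (j < d)%nat -> near_int (p i' j - p i j) (/ INR Q).
Proof.
  intros HQ HB.
  assert (Hc : forall i j, (cell Q (p i j) < Q)%nat)
    by (intros; apply cell_spec, HQ).
  destruct (nat_pigeonhole (Q ^ d) B
    (fun i => digits_value Q (fun j => cell Q (p i j)) d))
    as (i & i' & Hi & Hi' & E); [exact HB| |].
  { intros i _. apply digits_value_lt. auto. }
  exists i, i'. split; [exact Hi|]. split; [exact Hi'|].
  intros j Hj. apply same_cell_near; [exact HQ|]. symmetry.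
  apply (digits_value_inj Q (fun j => cell Q (p i j))
    (fun j => cell Q (p i' j)) d); auto.
Qed.

(** Two of the multiples [0..Q^d] of [beta] share a subcube of side [1/Q]; [m] is the difference of
    their multipliers. *)
Lemma dirichlet (d Q : nat) (beta : nat -> R) : (0 < Q)%nat ->
  exists m, (1 <= m <= Q ^ d)%nat /\
    forall j, (j < d)%nat -> near_int (INR m * beta j) (/ INR Q).
Proof.
  intros HQ.
  destruct (torus_pigeonhole d Q (S (Q ^ d)) (fun i j => INR i * beta j) HQ ltac:(lia))
    as (i & i' & Hi & Hi' & H).
  exists (i' - i)%nat. split; [lia|].
  intros j Hj. rewrite minus_INR by lia. rewrite Rmult_minus_distr_r. auto.
Qed.

(** * Subset sums and small values of diagonal forms *)

(* The indices [2t], [2t+1] form pairs; the binary digit [t] of [a] selects one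
   element of each pair, so that two different selections are incomparable. *)
Definition selected (a i : nat) : bool :=
  Bool.eqb (Nat.testbit a (i / 2)) (Nat.odd i).

Lemma selected_diff (k a a' : nat) :
  (a < 2 ^ k)%nat -> (a' < 2 ^ k)%nat -> a <> a' ->
  exists i, (i < 2 * k)%nat /\ selected a i = true /\ selected a' i = false.
Proof.
  intros Ha Ha' Hne.
  assert (Ht : exists t, (t < k)%nat /\ Nat.testbit a t <> Nat.testbit a' t).
  { apply NNPP. intros Hno. apply Hne.
    rewrite <- (Nat.mod_small a (2 ^ k)), <- (Nat.mod_small a' (2 ^ k)) by assumption.
    apply Nat.bits_inj. intros t.
    destruct (Nat.lt_ge_cases t k) as [L|L].
    - rewrite !Nat.mod_pow2_bits_low by exact L.
      apply NNPP. intros Hd. apply Hno. exists t. auto.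
    - rewrite !Nat.mod_pow2_bits_high by exact L. reflexivity. }
  destruct Ht as (t & Ht & Hd).
  exists (Nat.b2n (Nat.testbit a t) + 2 * t)%nat.
  assert (Hodd : Nat.odd (Nat.b2n (Nat.testbit a t) + 2 * t) = Nat.testbit a t).
  { rewrite Nat.odd_add_mul_2. destruct (Nat.testbit a t); reflexivity. }
  assert (Hdiv : ((Nat.b2n (Nat.testbit a t) + 2 * t) / 2 = t)%nat)
    by apply Nat.add_b2n_double_div2.
  unfold selected. rewrite Hodd, Hdiv.
  repeat split.
  - destruct (Nat.testbit a t); simpl; lia.
  - apply Bool.eqb_reflx.
  - apply Bool.eqb_false_iff. auto.
Qed.

(** Two of the [2 ^ k] selections have subset sums in the same subcube. Deleting their common
    elements keeps the difference of the sums, and incomparability of the selections leaves both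
    remainders nonempty. *)
Lemma balanced_subsets (d Q k : nat) (beta : nat -> nat -> R) :
  (0 < Q)%nat -> (Q ^ d < 2 ^ k)%nat ->
  exists u w : nat -> nat,
    (forall i, (u i + w i <= 1)%nat) /\
    (exists i, (i < 2 * k)%nat /\ u i = 1%nat) /\
    (exists i, (i < 2 * k)%nat /\ w i = 1%nat) /\
    forall j, (j < d)%nat ->
      near_int (rsum (2 * k) (fun i => INR (u i) * beta i j)
                - rsum (2 * k) (fun i => INR (w i) * beta i j)) (/ INR Q).
Proof.
  intros HQ Hk.
  destruct (torus_pigeonhole d Q (2 ^ k)
    (fun a j => rsum (2 * k) (fun i => INR (Nat.b2n (selected a i)) * beta i j)) HQ Hk)
    as (a & a' & Haa' & Ha' & H).
  exists (fun i => Nat.b2n (selected a' i && negb (selected a i))),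
         (fun i => Nat.b2n (selected a i && negb (selected a' i))).
  repeat split.
  - intros i. destruct (selected a i), (selected a' i); simpl; lia.
  - destruct (selected_diff k a' a) as (i & Hi & E & E'); try lia.
    exists i. rewrite E, E'. auto.
  - destruct (selected_diff k a a') as (i & Hi & E & E'); try lia.
    exists i. rewrite E, E'. auto.
  - intros j Hj. specialize (H j Hj). cbv beta in H.
    match goal with |- near_int ?x _ => match type of H with near_int ?y _ =>
      replace x with y; [exact H|] end end.
    enough (E : forall n f,
      rsum n (fun i => INR (Nat.b2n (selected a' i)) * f i)
      + rsum n (fun i => INR (Nat.b2n (selected a i && negb (selected a' i))) * f i)
      = rsum n (fun i => INR (Nat.b2n (selected a i)) * f i)
      + rsum n (fun i => INR (Nat.b2n (selected a' i && negb (selected a i))) * f i))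
      by (specialize (E (2 * k)%nat (fun i => beta i j)); cbv beta in E; lra).
    intros n f. rewrite <- !rsum_plus. apply rsum_ext. intros i _.
    destruct (selected a i), (selected a' i); simpl; ring.
Qed.

(** Two precisions occur: [q] is that of the final Dirichlet step and bounds the multiplier by
    [q ^ d]; [P] is that of the subset sums, and must be much finer because those errors get
    multiplied by up to [q ^ d * (2 * k + 1)]. *)
Lemma small_diagonal_form (d P q k : nat) (beta : nat -> nat -> R) :
  (0 < P)%nat -> (0 < q)%nat -> (P ^ d < 2 ^ k)%nat ->
  exists x : nat -> nat,
    (forall i, (x i <= q ^ d)%nat) /\
    (exists i, (i < 2 * k * (2 * k))%nat /\ (1 <= x i)%nat) /\
    forall j, (j < d)%nat ->
      near_int (rsum (2 * k * (2 * k)) (fun i => INR (x i) ^ 2 * beta i j))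
        (/ INR q + INR (q ^ d * (2 * k + 1)) * / INR P).
Proof.
  intros HP Hq Hk.
  set (K := (2 * k)%nat).
  assert (HPi : 0 < / INR P) by (apply Rinv_0_lt_compat, lt_0_INR, HP).
  assert (Hblock : forall b, exists uw : (nat -> nat) * (nat -> nat),
    (forall i, (fst uw i + snd uw i <= 1)%nat) /\
    (exists i, (i < K)%nat /\ fst uw i = 1%nat) /\
    (exists i, (i < K)%nat /\ snd uw i = 1%nat) /\
    forall j, (j < d)%nat ->
      near_int (rsum K (fun i => INR (fst uw i) * beta (b * K + i)%nat j)
                - rsum K (fun i => INR (snd uw i) * beta (b * K + i)%nat j)) (/ INR P)).
  { intros b.
    destruct (balanced_subsets d P k (fun i j => beta (b * K + i)%nat j) HP Hk)
      as (u & w & H).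
    exists (u, w). exact H. }
  destruct (functional_choice _ Hblock) as [UW HUW]. clear Hblock.
  set (U := fun b => fst (UW b)). set (W := fun b => snd (UW b)).
  set (g := fun b j => rsum K (fun i => INR (U b i) * beta (b * K + i)%nat j)).
  set (g' := fun b j => rsum K (fun i => INR (W b i) * beta (b * K + i)%nat j)).
  assert (HUW' : forall b, (forall i, (U b i + W b i <= 1)%nat) /\
    (exists i, (i < K)%nat /\ U b i = 1%nat) /\
    (exists i, (i < K)%nat /\ W b i = 1%nat) /\
    forall j, (j < d)%nat -> near_int (g b j - g' b j) (/ INR P)) by exact HUW.
  clear HUW. rename HUW' into HUW. clearbody U W.
  destruct (balanced_subsets d P k g HP Hk) as (u & w & Huw & Hu & Hw & Hg).
  fold K in Hu, Hw, Hg.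
  set (G := fun j => rsum K (fun b => INR (u b) * g b j)) in *.
  destruct (dirichlet d q G Hq) as (m & Hm & HmG).
  destruct (four_squares m) as (x1 & x2 & x3 & x4 & Hx).
  (* Index [n] is position [n mod K] of block [n / K]. The four sets are the [U]- and [W]-parts of
     the blocks chosen by [u], then those of the blocks chosen by [w]. *)
  set (x := fun n => let b := (n / K)%nat in let i := (n mod K)%nat in
    (u b * (U b i * x1 + W b i * x2) + w b * (U b i * x3 + W b i * x4))%nat).
  assert (Hxi : forall b i, (i < K)%nat -> x (b * K + i)%nat =
    (u b * (U b i * x1 + W b i * x2) + w b * (U b i * x3 + W b i * x4))%nat).
  { intros b i Hi. unfold x.
    replace ((b * K + i) / K)%nat with b
      by (rewrite Nat.div_add_l, Nat.div_small by lia; lia).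
    replace ((b * K + i) mod K)%nat with i
      by (rewrite Nat.add_comm, Nat.Div0.mod_add, Nat.mod_small by lia; lia).
    reflexivity. }
  exists x. repeat split.
  (* By disjointness [x n] is zero or a single [x_i], and [x_i <= x_i^2 <= m]. *)
  - intros n. apply Nat.le_trans with m; [|lia]. unfold x. cbv zeta.
    set (b := (n / K)%nat). set (i := (n mod K)%nat).
    specialize (Huw b). destruct (HUW b) as [HUi _]. specialize (HUi i).
    destruct (u b) as [|[|?]], (w b) as [|[|?]]; try lia;
    destruct (U b i) as [|[|?]], (W b i) as [|[|?]]; try lia; nia.
  - destruct Hu as (b & Hb & Eb). destruct Hw as (b' & Hb' & Eb').
    destruct (HUW b) as (_ & (i1 & Hi1 & E1) & (i2 & Hi2 & E2) & _).
    destruct (HUW b') as (_ & (i3 & Hi3 & E3) & (i4 & Hi4 & E4) & _).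
    (* As [m >= 1], some [x_i] is positive. Which one is unknown, hence the need for all four sets
       to be nonempty. *)
    assert (Hpos : (1 <= x1 \/ 1 <= x2 \/ 1 <= x3 \/ 1 <= x4)%nat) by nia.
    destruct Hpos as [H|[H|[H|H]]];
      [exists (b * K + i1)%nat|exists (b * K + i2)%nat
      |exists (b' * K + i3)%nat|exists (b' * K + i4)%nat];
      (split; [nia|rewrite Hxi by assumption]).
    + rewrite Eb, E1. nia.
    + rewrite Eb, E2. nia.
    + rewrite Eb', E3. nia.
    + rewrite Eb', E4. nia.
  - intros j Hj.
    (* [B b] is the weight of the [W]-part of block [b]. Replacing [g' b] by [g b] there, and then
       the [w]-sum by the [u]-sum [G], produces the two error terms of the exact identity below. *)
    set (B := fun b => (u b * (x2 * x2) + w b * (x4 * x4))%nat).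
    assert (E : rsum (K * K) (fun i => INR (x i) ^ 2 * beta i j) =
      INR m * G j
      - INR (x3 * x3 + x4 * x4) * (G j - rsum K (fun b => INR (w b) * g b j))
      - rsum K (fun b => INR (B b) * (g b j - g' b j))).
    { rewrite rsum_mul.
      transitivity (INR (x1 * x1 + x2 * x2) * G j
        + INR (x3 * x3 + x4 * x4) * rsum K (fun b => INR (w b) * g b j)
        + -1 * rsum K (fun b => INR (B b) * (g b j - g' b j))).
      2:{ rewrite Hx, !plus_INR. ring. }
      unfold G. rewrite <- !rsum_scal, <- !rsum_plus.
      apply rsum_ext. intros b _.
      transitivity (INR (u b * (x1 * x1) + w b * (x3 * x3)) * g b j
        + INR (B b) * g' b j).
      2:{ unfold B. rewrite !plus_INR, !mult_INR. ring. }
      unfold g, g'. rewrite <- !rsum_scal, <- !rsum_plus.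
      apply rsum_ext. intros i Hi. rewrite Hxi by exact Hi. unfold B.
      specialize (Huw b). destruct (HUW b) as [HUi _]. specialize (HUi i).
      destruct (u b) as [|[|?]], (w b) as [|[|?]]; try lia;
      destruct (U b i) as [|[|?]], (W b i) as [|[|?]]; try lia;
      rewrite ?plus_INR, ?mult_INR, ?plus_INR, ?mult_INR; simpl; ring. }
    rewrite E.
    eapply near_int_le.
    + apply near_int_minus; [apply near_int_minus|].
      * apply HmG, Hj.
      * apply near_int_scal. apply Hg, Hj.
      * apply near_int_rsum with (e := INR m * / INR P). intros b _.
        eapply near_int_le.
        -- apply near_int_scal. destruct (HUW b) as (_ & _ & _ & H). apply H, Hj.
        -- apply Rmult_le_compat_r; [lra|]. apply le_INR. unfold B.
           specialize (Huw b). destruct (u b) as [|[|?]], (w b) as [|[|?]]; lia.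
    + assert (H1 : INR (x3 * x3 + x4 * x4) <= INR m) by (apply le_INR; lia).
      assert (H2 : INR m <= INR (q ^ d)) by (apply le_INR; lia).
      fold K. rewrite (mult_INR (q ^ d)), (plus_INR K). change (INR 1) with 1.
      pose proof (pos_INR K).
      assert (INR (x3 * x3 + x4 * x4) * / INR P <= INR (q ^ d) * / INR P)
        by (apply Rmult_le_compat_r; lra).
      assert (INR K * (INR m * / INR P) <= INR K * (INR (q ^ d) * / INR P))
        by (apply Rmult_le_compat_l; [lra|apply Rmult_le_compat_r; lra]).
      lra.
Qed.

(** * Almost orthogonal integers and the expansion of the square *)

(** Each new integer comes from Dirichlet's theorem applied to all the numbers [2 * v i * alpha j]
    with [v i] already chosen; the pair [(i, j)] is coded as [t = i * d + j]. *)
Lemma orthogonal_family (d Q K : nat) (alpha : nat -> R) : (0 < Q)%nat ->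
  exists v : nat -> nat,
    (forall i, (i < K)%nat -> (1 <= v i <= Q ^ (K * d))%nat) /\
    forall i i' j, (i < i')%nat -> (i' < K)%nat -> (j < d)%nat ->
      near_int (2 * INR (v i) * INR (v i') * alpha j) (/ INR Q).
Proof.
  intros HQ. induction K as [|K (v & Hv & Hvv)].
  { exists (fun _ => O). split; intros; lia. }
  destruct (dirichlet (K * d) Q
    (fun t => 2 * INR (v (t / d)%nat) * alpha (t mod d)%nat) HQ) as (m & Hm & H).
  assert (Hpow : (Q ^ (K * d) <= Q ^ (S K * d))%nat)
    by (apply Nat.pow_le_mono_r; lia).
  exists (fun i => if Nat.eqb i K then m else v i). split.
  - intros i Hi. destruct (Nat.eqb_spec i K); [lia|].
    specialize (Hv i ltac:(lia)). lia.
  - intros i i' j Hi Hi' Hj.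
    destruct (Nat.eqb_spec i K); [lia|].
    destruct (Nat.eqb_spec i' K) as [->|]; [|apply Hvv; lia].
    specialize (H (i * d + j)%nat ltac:(nia)). cbv beta in H.
    rewrite Nat.div_add_l, Nat.div_small, Nat.add_0_r in H by lia.
    rewrite Nat.add_comm, Nat.Div0.mod_add, Nat.mod_small in H by lia.
    replace (2 * INR (v i) * INR m * alpha j)
      with (INR m * (2 * INR (v i) * alpha j)) by ring.
    exact H.
Qed.

(** Adding index [K] creates one diagonal term and [K] cross terms, each within [X^2 * e] of an
    integer; the count closes because [K^2 + K <= (K+1)^2]. *)
Lemma square_expansion (K X : nat) (v x : nat -> nat) (a e : R) : 0 <= e ->
  (forall i, (x i <= X)%nat) ->
  (forall i i', (i < i')%nat -> (i' < K)%nat ->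
     near_int (2 * INR (v i) * INR (v i') * a) e) ->
  near_int (INR (nsum K (fun i => x i * v i)%nat) ^ 2 * a
    - rsum K (fun i => INR (x i) ^ 2 * (INR (v i) ^ 2 * a)))
    (INR (K * K * (X * X)) * e).
Proof.
  intros He HX. induction K as [|K IH]; intros H.
  { simpl. replace _ with 0 by ring. apply near_int_0. lra. }
  cbn [nsum rsum]. rewrite plus_INR, mult_INR.
  set (n := INR (nsum K (fun i => x i * v i)%nat)) in *.
  set (s := rsum K (fun i => INR (x i) ^ 2 * (INR (v i) ^ 2 * a))) in *.
  match goal with |- near_int ?y _ =>
    replace y with ((n ^ 2 * a - s) + 2 * INR (x K) * INR (v K) * a * n) by ring end.
  eapply near_int_le.
  - apply near_int_plus.
    + apply IH. intros; apply H; lia.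
    + unfold n. rewrite INR_nsum, <- rsum_scal.
      apply near_int_rsum with (e := INR (X * X) * e). intros i Hi.
      eapply near_int_le.
      * replace (2 * INR (x K) * INR (v K) * a * INR (x i * v i))
          with (INR (x i * x K) * (2 * INR (v i) * INR (v K) * a))
          by (rewrite !mult_INR; ring).
        apply near_int_scal, H; lia.
      * apply Rmult_le_compat_r; [exact He|]. apply le_INR.
        apply Nat.mul_le_mono; apply HX.
  - rewrite <- Rmult_assoc, <- mult_INR, <- Rmult_plus_distr_r, <- plus_INR.
    apply Rmult_le_compat_r; [exact He|]. apply le_INR. nia.
Qed.

(** * Choice of parameters and conclusion *)

(** With [D = s * d], take [q = 2^s], so the coefficients are at most [2^D], and [P = 2^(8D)], which
    dictates [k = 8dD + 1]. Since [2k + 1 <= 2^(6D)], the subset-sum error is at most [2^(D+6D-8D)],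
    and precision [2^(-27D)] for the [v i] makes the cross-term error at most [2^(24D+2D-27D)]. Both
    are at most [2^(-s)], as is the Dirichlet error, whence the factor 3. *)
Lemma simultaneous_square_recurrence (d s : nat) (alpha : nat -> R) :
  (1 <= d)%nat -> (1 <= s)%nat ->
  exists n, (1 <= n <= 2 ^ (90 * 100 * d ^ 6 * s ^ 3))%nat /\
    forall j, (j < d)%nat -> near_int (INR n ^ 2 * alpha j) (3 * / 2 ^ s).
Proof.
  intros Hd Hs.
  set (D := (s * d)%nat).
  assert (HD : (1 <= D)%nat) by (unfold D; nia).
  set (k := (8 * d * D + 1)%nat).
  assert (HkD : (2 * k + 1 <= 2 ^ (6 * D))%nat).
  { assert (H8 : (8 * D <= 2 ^ (3 * D))%nat).
    { rewrite Nat.pow_mul_r. change (2 ^ 3)%nat with 8%nat.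
      clearbody D. clear -HD. induction HD as [|D HD IH]; simpl in *; lia. }
    replace (6 * D)%nat with (3 * D + 3 * D)%nat by lia.
    rewrite Nat.pow_add_r. assert (d <= D)%nat by (unfold D; nia).
    unfold k. clearbody D. nia. }
  assert (HqD : ((2 ^ s) ^ d = 2 ^ D)%nat) by (symmetry; apply Nat.pow_mul_r).
  assert (Hpow : forall a, (0 < 2 ^ a)%nat)
    by (intros a; apply Nat.neq_0_lt_0, Nat.pow_nonzero; lia).
  destruct (orthogonal_family d (2 ^ (27 * D)) (2 * k * (2 * k)) alpha (Hpow _))
    as (v & Hv & Hvv).
  destruct (small_diagonal_form d (2 ^ (8 * D)) (2 ^ s) k
    (fun i j => INR (v i) ^ 2 * alpha j) (Hpow _) (Hpow _)) as (x & Hx & Hx1 & Hxb).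
  { rewrite <- Nat.pow_mul_r. apply Nat.pow_lt_mono_r; unfold k; lia. }
  rewrite HqD in Hx, Hxb.
  set (K := (2 * k * (2 * k))%nat) in *.
  exists (nsum K (fun i => x i * v i)%nat). split; [split|].
  - destruct Hx1 as (i & Hi & Hxi).
    pose proof (nsum_ge_term K i (fun i => x i * v i)%nat Hi) as H. cbv beta in H.
    specialize (Hv i Hi). nia.
  - eapply Nat.le_trans.
    { apply (nsum_le K (2 ^ D * (2 ^ (27 * D)) ^ (K * d))).
      intros i Hi. apply Nat.mul_le_mono; [apply Hx|apply Hv, Hi]. }
    rewrite <- Nat.pow_mul_r, <- Nat.pow_add_r.
    assert (HK : (K <= 2 ^ (12 * D))%nat).
    { replace (12 * D)%nat with (6 * D + 6 * D)%nat by lia.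
      rewrite Nat.pow_add_r. apply Nat.mul_le_mono; lia. }
    eapply Nat.le_trans; [apply Nat.mul_le_mono_r, HK|].
    rewrite <- Nat.pow_add_r. apply Nat.pow_le_mono_r; [lia|].
    assert (Hk : (2 * k <= 18 * (d * D))%nat) by (unfold k; nia).
    assert (HK2 : (K <= 18 * (d * D) * (18 * (d * D)))%nat)
      by (apply Nat.mul_le_mono; exact Hk).
    rewrite <- (Nat.mul_assoc (90 * 100)).
    replace (d ^ 6 * s ^ 3)%nat with (d * D * (d * D) * (d * D))%nat
      by (unfold D; simpl; ring).
    (* The exponent to bound is [12D + D + 27D * K * d]. With [K <= (18z)^2] it is at most
       [(13 + 27 * 324) * z^3], and [8761 <= 9000]. *)
    set (z := (d * D)%nat) in *.
    assert (HDz : (D <= z)%nat) by (unfold z; nia).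
    assert (Hz3 : (z <= z * z * z)%nat) by (clearbody z; nia).
    assert (H27 : (27 * D * (K * d) <= 27 * 324 * (z * z * z))%nat).
    { replace (27 * D * (K * d))%nat with (27 * z * K)%nat by (unfold z; ring).
      clearbody z K. nia. }
    lia.
  - intros j Hj.
    replace (INR (nsum K (fun i => x i * v i)%nat) ^ 2 * alpha j)
      with ((INR (nsum K (fun i => x i * v i)%nat) ^ 2 * alpha j
        - rsum K (fun i => INR (x i) ^ 2 * (INR (v i) ^ 2 * alpha j)))
        + rsum K (fun i => INR (x i) ^ 2 * (INR (v i) ^ 2 * alpha j))) by ring.
    eapply near_int_le.
    { apply near_int_plus; [|apply Hxb, Hj].
      apply (square_expansion K (2 ^ D) v x (alpha j) (/ INR (2 ^ (27 * D)))).
      - apply Rlt_le, Rinv_0_lt_compat, lt_0_INR, Hpow.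
      - exact Hx.
      - intros i i' Hi Hi'. apply Hvv; assumption. }
    assert (Hinv : forall a b c, (a * 2 ^ c <= 2 ^ b)%nat ->
      INR a * / INR (2 ^ b) <= / 2 ^ c).
    { intros a b c H. apply le_INR in H. rewrite mult_INR, !pow_INR in H.
      rewrite pow_INR. change (INR 2) with 2 in *.
      assert (0 < 2 ^ b) by (apply pow_lt; lra).
      assert (0 < 2 ^ c) by (apply pow_lt; lra).
      apply (Rmult_le_reg_r (2 ^ b * 2 ^ c)); [nra|].
      replace (INR a * / 2 ^ b * (2 ^ b * 2 ^ c)) with (INR a * 2 ^ c) by (field; lra).
      replace (/ 2 ^ c * (2 ^ b * 2 ^ c)) with (2 ^ b) by (field; lra).
      exact H. }
    assert (HsD : (2 ^ s <= 2 ^ D)%nat)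
      by (apply Nat.pow_le_mono_r; [lia|unfold D; nia]).
    assert (E1 : INR (K * K * (2 ^ D * 2 ^ D)) * / INR (2 ^ (27 * D)) <= / 2 ^ s).
    { apply Hinv.
      replace (27 * D)%nat with (6 * D + 6 * D + (6 * D + 6 * D) + (D + D) + D)%nat by lia.
      rewrite !Nat.pow_add_r. repeat apply Nat.mul_le_mono; lia. }
    assert (E2 : INR (2 ^ D * (2 * k + 1)) * / INR (2 ^ (8 * D)) <= / 2 ^ s).
    { apply Hinv. replace (8 * D)%nat with (D + 6 * D + D)%nat by lia.
      rewrite !Nat.pow_add_r. repeat apply Nat.mul_le_mono; lia. }
    assert (E3 : / INR (2 ^ s) = / 2 ^ s) by (rewrite pow_INR; reflexivity).
    rewrite E3. lra.
Qed.

Theorem theorem1 :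
  exists c1 : R, 0 < c1 /\
    forall (d : nat) (alpha : nat -> R) (N : nat),
      (1 <= d)%nat -> (1 <= N)%nat ->
      exists n : nat, (1 <= n)%nat /\ (n <= N)%nat /\
        forall j : nat, (j < d)%nat ->
          dist_nint (INR n ^ 2 * alpha j)
            <= exp (- c1 * sqrt (sqrt (ln (INR N) / INR d ^ 10))).
Proof.
  exists (/ 100). split; [lra|]. intros d alpha N Hd HN.
  assert (HdR : 1 <= INR d) by (apply (le_INR 1), Hd).
  assert (HNR : 1 <= INR N) by (apply (le_INR 1), HN).
  assert (HlnN : 0 <= ln (INR N)).
  { apply Rnot_lt_le. rewrite <- ln_1. intros H. apply ln_lt_inv in H; lra. }
  assert (Hd10 : 0 < INR d ^ 10) by (apply pow_lt; lra).
  set (Y := ln (INR N) / INR d ^ 10).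
  assert (HY : 0 <= Y)
    by (apply Rmult_le_pos; [|apply Rlt_le, Rinv_0_lt_compat]; lra).
  set (T := sqrt (sqrt Y)).
  assert (HT : 0 <= T) by apply sqrt_pos.
  assert (HT4 : T ^ 4 = Y).
  { unfold T. replace 4%nat with (2 * 2)%nat by reflexivity.
    rewrite pow_mult, !pow2_sqrt; [reflexivity|exact HY|apply sqrt_pos]. }
  assert (HTN : INR d ^ 10 * T ^ 4 = ln (INR N))
    by (rewrite HT4; unfold Y; field; lra).
  destruct (Rle_lt_dec T 50) as [HT50|HT50].
  (* For [T <= 50] the target is at least [1 - T/100 >= 1/2], so [n = 1] already works. *)
  { exists 1%nat. split; [lia|]. split; [lia|]. intros j _.
    eapply Rle_trans; [apply dist_nint_le_half|].
    pose proof (exp_ineq1_le (- / 100 * T)). lra. }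
  destruct (archimed (/ 50 * T)) as [A1 A2].
  (* The rounded-up [T/50] gives the decay, since [2^(-t) <= exp(-t/2)]; the extra 2 absorbs the
     factor 3, as [3/4 <= 1]. *)
  set (s := (Z.to_nat (up (/ 50 * T)) + 2)%nat).
  assert (Hup : (0 <= up (/ 50 * T))%Z) by (apply le_IZR; lra).
  assert (HsR : INR s = IZR (up (/ 50 * T)) + 2).
  { unfold s. rewrite plus_INR, (INR_IZR_INZ (Z.to_nat _)), Z2Nat.id by exact Hup.
    reflexivity. }
  destruct (simultaneous_square_recurrence d s alpha Hd ltac:(unfold s; lia))
    as (n & [Hn1 Hn2] & Hn).
  exists n. split; [exact Hn1|]. split.
  - eapply Nat.le_trans; [exact Hn2|].
    set (E := (90 * 100 * d ^ 6 * s ^ 3)%nat).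
    apply INR_le. apply Rnot_lt_le. intros Hlt.
    apply ln_increasing in Hlt; [|lra].
    rewrite pow_INR, ln_pow in Hlt by (simpl; lra).
    change (INR 2) with 2 in Hlt.
    assert (Hln2 : ln 2 <= 1).
    { apply Rnot_lt_le. rewrite <- (ln_exp 1). intros H.
      apply ln_lt_inv in H; pose proof (exp_ineq1_le 1); lra. }
    (* Since [T > 50], [s <= T/50 + 3 <= 8T/100], so [9000 * s^3 <= 4.608 * T^3 <= T^4]. Together
       with [ln 2 <= 1] this gives [2^E <= N]. *)
    assert (HE : INR E <= INR d ^ 10 * T ^ 4).
    { unfold E. rewrite !mult_INR, !pow_INR.
      replace (INR 90 * INR 100) with 9000
        by (rewrite !INR_IZR_INZ, <- mult_IZR; reflexivity).
      assert (Hd6 : INR d ^ 6 <= INR d ^ 10) by (apply Rle_pow; [lra|lia]).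
      assert (Hd60 : 0 <= INR d ^ 6) by (apply pow_le; lra).
      assert (Hs3 : INR s ^ 3 <= (8 / 100 * T) ^ 3)
        by (apply pow_incr; split; [apply pos_INR|lra]).
      assert (HT3 : 9000 * (8 / 100 * T) ^ 3 <= T ^ 4).
      { assert (0 <= T ^ 3) by (apply pow_le; lra).
        replace (T ^ 4) with (T * T ^ 3) by ring.
        replace (9000 * (8 / 100 * T) ^ 3) with (4608 / 1000 * T ^ 3) by field.
        nra. }
      assert (0 <= T ^ 4) by (apply pow_le; lra).
      replace (9000 * INR d ^ 6 * INR s ^ 3) with (INR d ^ 6 * (9000 * INR s ^ 3)) by ring.
      apply Rle_trans with (INR d ^ 6 * T ^ 4).
      - apply Rmult_le_compat_l; lra.
      - apply Rmult_le_compat_r; lra. }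
    pose proof (pos_INR E). rewrite HTN in HE. nra.
  - intros j Hj. eapply Rle_trans; [apply near_int_dist_nint, Hn, Hj|].
    assert (Hhalf : / 2 <= exp (- / 2))
      by (pose proof (exp_ineq1_le (- / 2)); lra).
    assert (Hpow : forall t, (/ 2) ^ t <= exp (- / 2 * INR t)).
    { induction t as [|t IH].
      - simpl. rewrite Rmult_0_r, exp_0. lra.
      - rewrite S_INR, Rmult_plus_distr_l, Rmult_1_r, exp_plus. simpl.
        rewrite Rmult_comm. apply Rmult_le_compat; try lra. apply pow_le; lra. }
    set (t := Z.to_nat (up (/ 50 * T))) in *.
    assert (Ht : INR t = IZR (up (/ 50 * T)))
      by (unfold t; rewrite (INR_IZR_INZ (Z.to_nat _)), Z2Nat.id by exact Hup; reflexivity).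
    apply Rle_trans with ((/ 2) ^ t).
    + unfold s. rewrite <- pow_inv, pow_add.
      assert (0 < (/ 2) ^ t) by (apply pow_lt; lra). simpl pow at 2. lra.
    + eapply Rle_trans; [apply Hpow|].
      apply Rlt_le, exp_increasing. rewrite Ht. lra.
Qed.
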